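(* Let $X$ be a Banach space and let $(A,D(A))$ be the generator of a $C_0$-semigroup $(T(t))_{t\ge0}$ on $X$ such that $T(t)$ is a compact operator for each $t>0$. Let $f:\mathbb{R}\times X\to X$ be such that $f(\cdot,x)\in BS^1(\mathbb{R},X)$ for each $x\in X$, and assume that for every bounded subset $B\subset X$ the set $\{f(t,x): (t,x)\in\mathbb{R}\times B\}$ is relatively compact in $X$. If $x_0:[t_0,+\infty)\to X$ (for some $t_0\in\mathbb{R}$) is a bounded mild solution of the equation $x'(t)=Ax(t)+f(t,x(t))$, then its range is relatively compact in $X$.
   Context: Standing assumption: $f:\mathbb{R}\times X\to X$ is locally integrable in its first argument and continuous in its second argument. $BS^1(\mathbb{R},X)$ is the set of $u\in L^1_{loc}(\mathbb{R},X)$ with $\sup_{t\in\mathbb{R}}\int_t^{t+1}\|u(s)\|ds<\infty$. Mild solution on $[t_0,\infty)$: a continuous $x:[t_0,\infty)\to X$ with $x(t)=T(t-\sigma)x(\sigma)+\int_\sigma^t T(t-s)f(s,x(s))\,ds$ for all $t\ge\sigma\ge t_0$. *)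

(* Defs.v *)
From HB Require Import structures.
From mathcomp Require Import all_boot all_order all_algebra.
From mathcomp Require Import all_classical all_reals all_analysis.

Set Implicit Arguments.
Unset Strict Implicit.
Unset Printing Implicit Defensive.

Import Order.TTheory GRing.Theory Num.Theory.
Import numFieldNormedType.Exports.

Local Open Scope classical_set_scope.
Local Open Scope ring_scope.

Section bochner.
Context d (T : measurableType d) (R : realType).
Variable mu : {measure set T -> \bar R}.
Variable X : completeNormedModType R.
Implicit Types (D : set T) (g : T -> X) (v : X).

Definition integrable_simple D (s : T -> X) : Prop :=
  [/\ finite_set (range s),
      forall v, measurable (s @^-1` [set v]) &
      forall v, v != 0 -> (mu (D `&` s @^-1` [set v]) < +oo)%E].

(* [fine] only matters for v = 0, where the measure may be infinite and the
   term vanishes anyway. *)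
Definition simple_integral D (s : T -> X) : X :=
  \sum_(v \in range s) fine (mu (D `&` s @^-1` [set v])) *: v.

(* Almost everywhere convergence makes g strongly measurable with respect to
   the completion of mu; the last integral is then the usual one even though
   the integrand need not be measurable for the sigma-algebra of T. *)
Definition bochner_approx D g (s_ : nat -> T -> X) : Prop :=
  [/\ forall n, integrable_simple D (s_ n),
      {ae mu, forall t, D t -> s_ n t @[n --> \oo] --> g t} &
      (\int[mu]_(t in D) (`|s_ n t - g t|)%:E)%E @[n --> \oo] --> 0%E].

Definition bochner_integrable D g : Prop := exists s_, bochner_approx D g s_.

Definition is_bochner_integral D g v : Prop :=
  exists2 s_, bochner_approx D g s_ &
    simple_integral D (s_ n) @[n --> \oo] --> v.

(* Equal to 0 when g is not Bochner integrable on D. *)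
Definition bochner_integral D g : X := xget 0 (is_bochner_integral D g).

End bochner.

Section evolution.
Context (R : realType) (X : completeNormedModType R).
Implicit Types (u : R -> X) (T : R -> {linear X -> X}) (f : R -> X -> X).

Definition locally_bochner_integrable u : Prop :=
  forall a b : R, bochner_integrable lebesgue_measure `[a, b] u.

Definition BS1 u : Prop :=
  locally_bochner_integrable u /\
  (ereal_sup [set \int[lebesgue_measure]_(s in `[t, (t + 1)%R]) (`|u s|)%:E
             | t in [set: R]] < +oo)%E.

(* The operators T t with t < 0 play no role; they are only linear. *)
Definition C0_semigroup T : Prop :=
  [/\ forall t, 0 <= t -> continuous (T t),
      forall x, T 0 x = x,
      forall s t x, 0 <= s -> 0 <= t -> T (s + t) x = T s (T t x) &
      forall x, T t x @[t --> 0^'+] --> x].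

(* D is the set of x at which the right derivative of T t x at t = 0 exists,
   and A x is that derivative; the values of A outside D are irrelevant. *)
Definition is_generator T (D : set X) (A : X -> X) : Prop :=
  forall x y, (D x /\ A x = y) <->
    h^-1 *: (T h x - x) @[h --> 0^'+] --> y.

Definition compact_operator (L : X -> X) : Prop :=
  forall B : set X, bounded_set B -> precompact (L @` B).

(* Mild solution on [t0, +oo[ of x' = A x + f(t, x), where A generates T; the
   values of x before t0 are irrelevant. *)
Definition mild_solution T f (t0 : R) (x : R -> X) : Prop :=
  {within `[t0, +oo[, continuous x} /\
  forall sigma t, t0 <= sigma -> sigma <= t ->
    let g := fun s => T (t - s) (f s (x s)) in
    bochner_integrable lebesgue_measure `[sigma, t] g /\
    x t = T (t - sigma) (x sigma) +
          bochner_integral lebesgue_measure `[sigma, t] g.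

End evolution.

(* Main.v *)
(* Let K bound |f t (x0 s)| over all t and all s >= t0, and let M bound
   |T s y| for s in [0, d], |y| <= K (uniform boundedness principle).  For
   0 < h <= d and t > t0 + h, the mild solution formula on [t - h, t] puts
   x0 t within h M of T h (x0 (t - h)), a point of the relatively compact image
   under T h of the range of x0.  Together with the compact arc
   x0 ([t0, t0 + h]) this approximates the range by compact sets to any
   precision, since h is arbitrary. *)
Require Import Defs.
From mathcomp Require Import all_boot all_order all_algebra.
From mathcomp Require Import all_classical all_reals all_analysis.
From mathcomp Require Import measurable_realfun.
Import Order.TTheory GRing.Theory Num.Theory.
Import numFieldNormedType.Exports.
Local Open Scope classical_set_scope.
Local Open Scope ring_scope.

(** The integral of a nonnegative function is a supremum over the nonnegative simple functions below
    it; a larger function admits more of them. *)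
Lemma ge0_le_lower_integral d (T : measurableType d) (R : realType)
    (mu : {measure set T -> \bar R}) (D : set T) (f g : T -> \bar R) :
  (forall x, D x -> 0 <= f x)%E -> (forall x, D x -> f x <= g x)%E ->
  (\int[mu]_(x in D) f x <= \int[mu]_(x in D) g x)%E.
Proof.
move=> f0 fg.
have g0 x : D x -> (0 <= g x)%E by move=> Dx; exact: le_trans (f0 x Dx) (fg x Dx).
rewrite !ge0_integralE//; apply: le_ereal_sup => _ [h hf <-]; exists h => // x.
by apply: le_trans (hf x) _; apply: lee_restrict.
Qed.

Section bochner_norm.
Context d (T : measurableType d) (R : realType).
Variable mu : {measure set T -> \bar R}.
Variable X : completeNormedModType R.
Variable D : set T.
Hypotheses (mD : measurable D) (muD : (mu D < +oo)%E).

(** [psi (s t)] is a finite combination of indicators of the fibres of [s]. Used with [psi = 1] and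
    with the excess of the norm over [C]. *)
Lemma integral_comp_simple (s : T -> X) (psi : X -> R) :
  integrable_simple mu D s -> (forall v, 0 <= psi v) ->
  (\int[mu]_(t in D) (psi (s t))%:E)%E =
  (\sum_(v <- finmap.enum_fset (fset_set (range s)))
     psi v * fine (mu (D `&` s @^-1` [set v])))%:E.
Proof.
move=> [fs ms _] psi0.
(* This includes the fibre over 0, so [fine] loses nothing below. *)
have finD v : (mu (D `&` s @^-1` [set v]) < +oo)%E.
  by apply: le_lt_trans muD; rewrite le_measure ?inE//; exact: measurableI.
under eq_integral => t _.
  have -> : (psi (s t))%:E = (\sum_(v <- finmap.enum_fset (fset_set (range s)))
      (psi v)%:E * (\1_(s @^-1` [set v]) t)%:E)%E.
    rewrite (bigD1_seq (s t)) ?finmap.fset_uniq//=; last first.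
      by rewrite in_fset_set// inE; exists t.
    rewrite indicE mem_set// mule1 big1 ?adde0// => v vst.
    by rewrite indicE memNset ?mule0// => /= /esym/eqP; rewrite (negbTE vst).
  over.
rewrite ge0_integral_sum//; last 2 first.
- move=> v; apply: measurable_funeM; apply/measurable_EFinP.
  exact: measurable_indic.
- by move=> v t _; rewrite mule_ge0// lee_fin.
rewrite -sumEFin; apply: eq_bigr => v _.
rewrite ge0_integralZl_EFin//; last first.
  by apply/measurable_EFinP; exact: measurable_indic.
rewrite integral_indic// setIC EFinM fineK// ge0_fin_numE//.
Qed.

(* As g need not be measurable, the integrals involving it are only lower
   integrals, which are monotone but not subadditive; hence the comparison of
   the simple function max(|s| - C, 0) with |s - g|. *)
Lemma norm_simple_integral_le (g s : T -> X) (C : R) :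
  0 <= C -> (forall t, D t -> `|g t| <= C) -> integrable_simple mu D s ->
  (`|simple_integral mu D s|%:E <=
   \int[mu]_(t in D) (`|s t - g t|)%:E + (C * fine (mu D))%:E)%E.
Proof.
move=> C0 gC ss; have [fs _ _] := ss.
have mu_cover := integral_comp_simple s (fun=> 1) ss (fun=> ler01).
rewrite integral_cst// mul1e in mu_cover.
have excess_ge0 (v : X) : 0 <= Num.max (`|v| - C) 0 by rewrite le_max lexx orbT.
have := @ge0_le_lower_integral _ _ _ mu D
  (fun t => (Num.max (`|s t| - C) 0)%:E) (fun t => `|s t - g t|%:E).
rewrite (integral_comp_simple s (fun v => Num.max (`|v| - C) 0) ss excess_ge0).
move=> le_int; apply: le_trans (leeD2r _ (le_int _ _)); last 2 first.
- by move=> t _; rewrite lee_fin.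
- move=> t Dt; rewrite lee_fin ge_max normr_ge0 andbT lerBlDr.
  rewrite -[X in `|X| <= _](subrK (g t)).
  by apply: le_trans (ler_normD _ _) _; rewrite lerD2l gC.
rewrite mu_cover/= -EFinD lee_fin /simple_integral fsbig_finite//=.
apply: le_trans (ler_norm_sum _ _ _) _.
rewrite mulr_sumr -big_split/=; apply: ler_sum => v _.
rewrite normrZ ger0_norm ?fine_ge0// mul1r -mulrDl mulrC ler_wpM2r ?fine_ge0//.
by rewrite -lerBlDr le_max lexx.
Qed.

(** Limit of the preceding inequality along an approximating sequence, whose error integrals tend to
    0. *)
Lemma norm_bochner_integral_le (g : T -> X) (C : R) :
  0 <= C -> (forall t, D t -> `|g t| <= C) ->
  `|bochner_integral mu D g| <= C * fine (mu D).
Proof.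
move=> C0 gC; rewrite /bochner_integral.
(* Without an integral, the default value 0 satisfies the bound. *)
case: xgetP => [v _ [s_ [ss _ s_g] s_v]|_]; last first.
  by rewrite normr0 mulr_ge0// fine_ge0.
have norm_cvg : `|simple_integral mu D (s_ n)|%:E @[n --> \oo] --> `|v|%:E.
  by apply: cvg_EFin; [exact: nearW|exact: cvg_norm].
have bound_cvg : (\int[mu]_(t in D) (`|s_ n t - g t|)%:E +
    (C * fine (mu D))%:E)%E @[n --> \oo] --> (C * fine (mu D))%:E.
  by rewrite -[X in _ --> X]add0e; apply: cvgeD => //; exact: cvg_cst.
rewrite -lee_fin -(cvg_lim _ norm_cvg)// -(cvg_lim _ bound_cvg)//.
apply: lee_lim; [exact: cvgP norm_cvg|exact: cvgP bound_cvg|].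
by apply: nearW => n; exact: norm_simple_integral_le.
Qed.

End bochner_norm.

(** Every ultrafilter containing the closure of [S] is Cauchy, hence converges by completeness. *)
Lemma precompact_approx (R : realType) (X : completeNormedModType R)
    (S : set X) :
  (forall e : R, 0 < e -> exists2 K, compact K &
    forall x, S x -> exists2 y, K y & `|x - y| < e) ->
  precompact S.
Proof.
move=> approx; rewrite precompactE compact_ultra => F UF FS.
have FF : ProperFilter F := @ultra_proper _ F UF.
suff cF : cauchy_ex F.
  have /cvg_ex[p Fp] : cvg F by apply: cauchy_cvg; exact: cauchy_exP.
  exists p; split => //; apply: (@closed_closure _ S) => B pB.
  exact: filter_ex (filterI FS (Fp _ pB)).
move=> e e0.
have e20 : 0 < e / 2 by rewrite divr_gt0.
have e40 : 0 < e / 2 / 2 by rewrite divr_gt0.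
have [K cK SK] := approx _ e40.
(* [phi] moves the closure of [S] into [K] by less than [e / 2]; the image ultrafilter then clusters
   at some [q] in [K]. *)
have /choice[phi phiP] : forall p, exists y,
    closure S p -> K y /\ `|p - y| < e / 2.
  move=> p; have [Sp|nSp] := pselect (closure S p); last by exists 0.
  have [x [Sx px]] := Sp _ (nbhsx_ballx p _ e40).
  have [y Ky xy] := SK _ Sx; exists y => _; split => //.
  rewrite -(subrKA x) [ltRHS]splitr (le_lt_trans (ler_normD _ _))// ltrD//.
  by rewrite -ball_normE in px.
have [q [Kq qF]] : K `&` cluster (phi @ F) !=set0.
  have FK : F (phi @^-1` K) by apply: filterS FS => p /phiP[].
  exact: cK _ FK.
(* Either [phi] is within [e / 2] of [q] on a set of [F], so [ball q e] is in [F], or the complement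
   contradicts clustering at [q]. *)
exists q; have [|Fc] := in_ultra_setVsetC (phi @^-1` ball q (e / 2)) UF.
  move=> Fq; apply: filterS (filterI FS Fq) => p [/phiP[_ pphi]] /=.
  rewrite -!ball_normE/= => qphi; rewrite -(subrKA (phi p)) [ltRHS]splitr.
  by rewrite (le_lt_trans (ler_normD _ _))// ltrD// distrC.
have [y [nby bY]] := qF (~` ball q (e / 2)) _ Fc (nbhsx_ballx q _ e20).
by case: (nby bY).
Qed.

(** Otherwise some [s n] tending to 0 make [T (s n)] unbounded on the ball of radius [r], although
    [T (s n) y] tends to [y] for each [y], against uniform boundedness. *)
Lemma C0_semigroup_bounded_near0 (R : realType) (X : completeNormedModType R)
    (T : R -> {linear X -> X}) (r : R) :
  C0_semigroup T ->
  exists d M : R, [/\ 0 < d, 0 <= M &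
    forall s x, 0 <= s <= d -> `|x| <= r -> `|T s x| <= M].
Proof.
move=> [cT T0 _ sT]; apply: contrapT => unbd.
have /choice[s /choice[x sx]] : forall n : nat, exists s : R, exists x : X,
    [/\ 0 <= s <= n.+1%:R^-1, `|x| <= r & n%:R < `|T s x|].
  move=> n; apply: contrapT => nsx; apply: unbd.
  exists n.+1%:R^-1, n%:R; split; rewrite ?invr_gt0// => s x sn xr.
  by rewrite leNgt; apply/negP => nT; apply: nsx; exists s, x.
have s_ge0 n : 0 <= s n by have [/andP[]] := sx n.
have [M TM] : exists M, forall f, range (fun n => T (s n) : X -> X) f ->
    forall y, `|y| <= r -> `|f y| <= M.
  apply: Banach_Steinhauss => [_ [n _ <-]|y].
    split; last exact: linearP.
    by apply/bounded_funP/linear_bounded_continuous/cT.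
  have Tsy : T (s n) y @[n --> \oo] --> y.
    apply/cvgrPdist_lt => e e0.
    have /cvgrPdist_lt/(_ _ e0) := sT y.
    rewrite near_withinE near_simpl => /nbhs_ballP[d /= d0 dT].
    near=> n.
    (* The limit at [0^'+] says nothing about the time 0 itself. *)
    have [->|sn0] := eqVneq (s n) 0; first by rewrite T0 subrr normr0.
    apply: dT; last by rewrite lt_def sn0 s_ge0.
    rewrite /ball/= sub0r normrN ger0_norm//.
    have [/andP[_ sn] _ _] := sx n; apply: le_lt_trans sn _.
    by near: n; exact: near_infty_natSinv_lt (PosNum d0).
  have [M [_ bM]] := cvg_seq_bounded (cvgP _ Tsy).
  by exists (M + 1) => _ [n _ <-]; apply: bM => //; rewrite ltrDl.
have [_ xr] := sx (Num.Def.truncn M).+1.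
rewrite ltNge => /negP; apply; apply: le_trans (TM _ _ _ xr) _; first by eexists.
by rewrite ltW// truncnS_gt.
Unshelve. all: by end_near. Qed.

Lemma bounded_set_norm (R : realType) (X : normedModType R) (S : set X) :
  bounded_set S -> exists2 r, 0 <= r & forall x, S x -> `|x| <= r.
Proof.
move=> [M [_ SM]]; exists (`|M| + 1); first by rewrite addr_ge0.
by apply: SM; rewrite (le_lt_trans (ler_norm _))// ltrDl.
Qed.

Theorem proposition3p1 (R : realType) (X : completeNormedModType R)
  (T : R -> {linear X -> X}) (DA : set X) (A : X -> X) (f : R -> X -> X)
  (t0 : R) (x0 : R -> X) :
  C0_semigroup T ->
  is_generator T DA A ->
  (forall t, 0 < t -> compact_operator (T t)) ->
  (forall x, locally_bochner_integrable (fun t => f t x)) ->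
  (forall t, continuous (f t)) ->
  (forall x, BS1 (fun t => f t x)) ->
  (forall B : set X, bounded_set B ->
    precompact [set f t x | t in [set: R] & x in B]) ->
  mild_solution T f t0 x0 ->
  bounded_set (x0 @` `[t0, +oo[) ->
  precompact (x0 @` `[t0, +oo[).
Proof.
move=> semiT _ compT _ _ _ precf [x0c x0mild] bx0.
have [r r0 fr] : exists2 r, 0 <= r &
    forall t s, t0 <= s -> `|f t (x0 s)| <= r.
  have := precf _ bx0; rewrite precompactE => /compact_bounded/bounded_set_norm.
  move=> [r r0 rP]; exists r => // t s ts; apply: rP; apply: subset_closure.
  by exists t => //; exists (x0 s) => //; exists s => //=; rewrite in_itv/= ts.
have [d [M [d0 M0 TM]]] := C0_semigroup_bounded_near0 _ _ T r semiT.
apply: precompact_approx => e e0.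
(* [h <= d] makes [TM] applicable on [[0, h]]; the other bound gives [M * h < e], with [M + 1]
   because [M] may be 0. *)
pose h := Num.min d (e / (M + 1)).
have h0 : 0 < h by rewrite lt_min d0 divr_gt0// ltr_wpDl.
have hMe : M * h < e.
  apply: (@le_lt_trans _ _ (M * (e / (M + 1)))).
    by rewrite ler_wpM2l// ge_min lexx orbT.
  by rewrite mulrA ltr_pdivrMr ?ltr_wpDl// mulrDr mulr1 mulrC ltrDl.
exists (x0 @` `[t0, t0 + h] `|` closure (T h @` (x0 @` `[t0, +oo[))).
  apply: compactU.
    apply: continuous_compact; last exact: segment_compact.
    by apply: continuous_subspaceW x0c => t/=; rewrite !in_itv/= andbT => /andP[].
  by rewrite -precompactE; exact: compT.
move=> _ [t /= + <-]; rewrite in_itv/= andbT => t0t.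
(* In the first case [t - h] may precede [t0], so [x0 t] approximates itself. *)
have [tth|tht] := leP t (t0 + h).
  exists (x0 t); last by rewrite subrr normr0.
  by left; exists t => //=; rewrite in_itv/= t0t.
have t0th : t0 <= t - h by rewrite lerBrDr ltW.
have tht' : t - h <= t by rewrite gerBl ltW.
have [_] := x0mild _ _ t0th tht'; rewrite subKr => x0t.
exists (T h (x0 (t - h))).
  right; apply: subset_closure; exists (x0 (t - h)) => //.
  by exists (t - h) => //=; rewrite in_itv/= t0th.
(* What remains is the integral over [[t - h, t]], of norm at most [M * h]. *)
rewrite {1}x0t addrC addKr.
have muth : lebesgue_measure `[t - h, t] = h%:E.
  by rewrite lebesgue_measure_itv/= lte_fin gtrBl h0 -EFinB subKr.
apply: le_lt_trans (@norm_bochner_integral_le _ _ _ _ _ _ _ _ _ M M0 _) _ => //.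
- by rewrite [ltLHS]muth ltry.
- move=> s /=; rewrite in_itv/= => /andP[ths st]; apply: TM.
    rewrite subr_ge0 st/= lerBlDr -lerBlDl (le_trans _ ths)// lerD2l lerN2.
    by rewrite ge_min lexx.
  by apply: fr; exact: le_trans ths.
- by rewrite [X in fine X]muth.
Qed.
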